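(* Let $n\geq2$. Let $B,\lambda_1,\dots,\lambda_{n-1}\in\mathbb{R}\setminus\{0\}$, $E>1$, $a_1,\dots,a_{n-1}>0$, $\alpha,\psi_1,\dots,\psi_{n-1}\in\mathbb{R}$ and $K\in\mathbb{C}$ be constants. Let $I\subset\mathbb{R}$ be a connected open neighborhood of $0\in\mathbb{R}$ such that $$E\Big\{\prod_{k=1}^{n-1}(1+2a_kB\lambda_ks)\Big\}e^{2B\alpha s}-1>0\quad\text{and}\quad\frac{1}{a_j}+2\lambda_jBs>0$$ for every $j\in\{1,\dots,n-1\}$ and every $s\in I$. Define $r_1,\dots,r_{n-1}:I\to\mathbb{R}$ by $$r_j(s)=\sqrt{\frac{1}{a_j}+2\lambda_jBs}$$ and $\phi_1,\dots,\phi_{n-1}:I\to\mathbb{R}$ by $$\phi_j(s)=\psi_j+\int_0^s\frac{\lambda_j|B|}{\big(\frac{1}{a_j}+2\lambda_jBt\big)\sqrt{E\{\prod_{k=1}^{n-1}(1+2a_kB\lambda_kt)\}e^{2B\alpha t}-1}}\,dt.$$ Then the submanifold $L$ in $\mathbb{C}^n$ given by $$L=\Big\{\Big(x_1r_1(s)e^{i\phi_1(s)},\dots,x_{n-1}r_{n-1}(s)e^{i\phi_{n-1}(s)},\ -\frac12\sum_{j=1}^{n-1}\lambda_jx_j^2+Bs+i|B|\int_0^s\frac{dt}{\sqrt{E\{\prod_{k=1}^{n-1}(1+2a_kB\lambda_kt)\}e^{2B\alpha t}-1}}+K\Big)\ :\ x_1,\dots,x_{n-1}\in\mathbb{R},\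 s\in I\Big\}$$ is an immersed Lagrangian submanifold, and its mean curvature vector $H$ satisfies $H\equiv T^{\perp}$, where $T=(0,\dots,0,\alpha)\in\mathbb{C}^n$.
   Context: $\mathbb{C}^n\cong\mathbb{R}^{2n}$ carries its standard Euclidean metric, complex structure $J$ (multiplication by $i$) and symplectic form. $L$ is regarded as an immersed submanifold via the displayed parametrization by $((x_1,\dots,x_{n-1}),s)\in\mathbb{R}^{n-1}\times I$. $T^{\perp}$ denotes the orthogonal projection of the constant vector $T$ to the normal bundle of $L$, and $H$ is the mean curvature vector of $L$ (the trace of the second fundamental form). *)

(* Defs.v *)
From HB Require Import structures.
From mathcomp Require Import all_boot all_order all_algebra.
From mathcomp Require Import complex.
From mathcomp Require Import all_classical all_reals all_analysis.

Set Implicit Arguments.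
Unset Strict Implicit.
Unset Printing Implicit Defensive.

Import Order.TTheory GRing.Theory Num.Theory.
Import numFieldNormedType.Exports.

Local Open Scope classical_set_scope.
Local Open Scope ring_scope.

(* The integral of f from a to b, with the usual sign convention when b < a
   (\int alone is an integral over a set and does not see the orientation). *)
Definition oriented_integral (R : realType) (a b : R) (f : R -> R) : R :=
  if a <= b then \int[lebesgue_measure]_(t in `[a, b]) f t
  else - \int[lebesgue_measure]_(t in `[b, a]) f t.

(* e^{i t} for real t; there is no complex exponential in the libraries. *)
Definition expi (R : realType) (t : R) : R[i] := Complex (cos t) (sin t).

Section EuclideanSubmanifolds.
Variables (R : realType) (d N : nat).
Implicit Types (U : set 'rV[R]_d) (F : 'rV[R]_d -> 'rV[R]_N) (p : 'rV[R]_d).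

Definition dot (u v : 'rV[R]_N) : R := \sum_(i < N) u 0 i * v 0 i.

(* C^oo on the open set U. Differentiability of every iterated directional
   derivative contains the continuity of every iterated derivative. *)
Definition smooth_on U F : Prop :=
  forall (vs : seq 'rV[R]_d) (p : 'rV[R]_d), U p ->
    differentiable (foldr (fun (v : 'rV[R]_d) (G : 'rV[R]_d -> 'rV[R]_N) =>
                             'D_v G) F vs) p.

Definition immersion_on U F : Prop :=
  smooth_on U F /\ forall p, U p -> injective ('d F p).

(* Subspaces of R^N are row spaces: row i of 'J F p is the i-th partial
   derivative of F at p, and a row u lies in the row kernel of ('J F p)^T
   exactly when it is orthogonal to all of these. *)
Definition tangent_subspace F p : 'M[R]_N := <<'J F p>>%MS.
Definition normal_subspace F p : 'M[R]_N := kermx ('J F p)^T.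

Definition normal_proj F p (w : 'rV[R]_N) : 'rV[R]_N :=
  w *m proj_mx (normal_subspace F p) (tangent_subspace F p).

Definition induced_metric F p : 'M[R]_d :=
  \matrix_(i, j) dot ('d F p (delta_mx 0 i)) ('d F p (delta_mx 0 j)).

(* The normal part of the ambient derivative, in the direction 'd F p u, of the
   tangent field q |-> 'd F q v. *)
Definition second_fundamental_form F p (u v : 'rV[R]_d) : 'rV[R]_N :=
  normal_proj F p ('D_u ('D_v F) p).

(* Not divided by the dimension d. *)
Definition mean_curvature F p : 'rV[R]_N :=
  \sum_(i < d) \sum_(j < d) invmx (induced_metric F p) i j *:
    second_fundamental_form F p (delta_mx 0 i) (delta_mx 0 j).

End EuclideanSubmanifolds.

Section ComplexSpace.
Variables (R : realType) (n : nat).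

(* C^n is identified with R^(2n) by (z_k)_k |-> ((Re z_k)_k, (Im z_k)_k). *)
Definition realify (z : 'rV[R[i]]_n) : 'rV[R]_(n + n) :=
  row_mx (\row_k complex.Re (z 0 k)) (\row_k complex.Im (z 0 k)).

(* Multiplication by i. *)
Definition cstruct (w : 'rV[R]_(n + n)) : 'rV[R]_(n + n) :=
  row_mx (- rsubmx w) (lsubmx w).

(* This is sum_k dx_k /\ dy_k. *)
Definition symplectic_form (u v : 'rV[R]_(n + n)) : R := dot (cstruct u) v.

(* The source has dimension n, half of that of the target. *)
Definition lagrangian_immersion_on (U : set 'rV[R]_n)
    (F : 'rV[R]_n -> 'rV[R]_(n + n)) : Prop :=
  immersion_on U F /\
  forall p, U p -> forall u v : 'rV[R]_n,
    symplectic_form ('d F p u) ('d F p v) = 0.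

End ComplexSpace.

(* Main.v *)
Require Import Defs.
From HB Require Import structures.
From mathcomp Require Import all_boot all_order all_algebra.
From mathcomp Require Import complex.
From mathcomp Require Import all_classical all_reals all_analysis.
From mathcomp Require Import ring.

Set Implicit Arguments.
Unset Strict Implicit.
Unset Printing Implicit Defensive.

Import Order.TTheory GRing.Theory Num.Theory.
Import numFieldNormedType.Exports.

Local Open Scope classical_set_scope.
Local Open Scope complex_scope.
Local Open Scope ring_scope.

(** Put [b = |B| / sqrt Q], [c = B + i b], [rho_j = 1 / r_j] and write [e_j] for
    the vector with j-th entry [exp (i phi_j)] and [e_n] for the last basis
    vector. The formulas for [r_j] and [phi_j] make
    [d_j F = r_j e_j - lambda_j x_j e_n] and [d_s F = c W], where
    [W = e_n + sum_j lambda_j x_j rho_j e_j]. The vectors [d_j F] have real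
    Hermitian products and [W] is Hermitian orthogonal to all of them, so [F] is
    Lagrangian ([symplectic_dF]), and its metric is block diagonal: a rank one
    perturbation of the diagonal matrix of the [r_j ^ 2], and
    [|d_s F| ^ 2 = |c| ^ 2 w] with [w = |W| ^ 2]. So the metric is positive definite,
    the differential of [F] is injective ([dF_eq0]), and the inverse metric is
    explicit ([inv_metricP]).

    Differentiating once more gives [d_j d_k F = - lambda_j delta_jk e_n] and
    [d_s d_s F = i b' W - |c| ^ 2 sum_j lambda_j ^ 2 x_j rho_j ^ 3 e_j]; the mixed
    derivatives do not meet the inverse metric. The definition of [Q] gives
    [B b' = - (sigma + alpha) b |c| ^ 2] with [sigma = sum_j lambda_j rho_j ^ 2].
    With these values the trace of the second derivatives minus [T] is an explicit
    combination of the [d_j F] and [d_s F] ([trace_d2F]), and a tangent vector has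
    no normal part ([mean_curvature_eq]).

    Smoothness needs no computation of higher derivatives: the functions [r_j],
    [rho_j], [cos phi_j], [sin phi_j], [Q + 1], [1 / sqrt Q] and the integral of
    [1 / sqrt Q] satisfy a system of polynomial differential equations, so every
    iterated derivative of a coordinate of [F] is a polynomial in these functions
    and the coordinates [x_j] ([smooth_on_polynomial]). *)

(** * The derivative of the oriented integral *)

Section Calculus.
Variable R : realType.

(** The fundamental theorem of calculus on both sides of the base point. *)
Lemma is_derive_oriented_integral (I : set R) (f : R -> R) (a s : R) :
  open I -> connected I -> (forall t, I t -> {for t, continuous f}) ->
  I a -> I s ->
  is_derive s 1 (fun t => oriented_integral a t f) (f s).
Proof.
move=> oI /connected_intervalP cI fI Ia Is.
pose lo := Num.min a s; pose hi := Num.max a s.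
have Ilo : I lo by rewrite /lo; case: leP.
have Ihi : I hi by rewrite /hi; case: leP.
have [e e0 eI] : exists2 e : R, 0 < e & I (lo - e) /\ I (hi + e).
  have [e1 /= e10 e1I] : nbhs lo I by exact: open_nbhs_nbhs.
  have [e2 /= e20 e2I] : nbhs hi I by exact: open_nbhs_nbhs.
  have m0 : 0 < Num.min e1 e2 / 2 by rewrite divr_gt0 // lt_min e10.
  have m1 : Num.min e1 e2 / 2 < Num.min e1 e2.
    by rewrite ltr_pdivrMr // ltr_pMr ?ltr1n // lt_min e10.
  have /andP[me1 me2] : (Num.min e1 e2 / 2 < e1) && (Num.min e1 e2 / 2 < e2).
    by rewrite -lt_min.
  exists (Num.min e1 e2 / 2) => //; split.
    by apply: e1I; rewrite /ball_ /= opprB addrC subrK gtr0_norm.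
  by apply: e2I; rewrite /ball_ /= opprD addrA subrr add0r normrN gtr0_norm.
case: eI; set c := lo - e; set d := hi + e => Ic Id.
have [ca cs] : c < a /\ c < s.
  have loe : c < lo by rewrite ltrBlDr ltrDl.
  by split; apply: (lt_le_trans loe); rewrite ge_min lexx ?orbT.
have [ad sd] : a < d /\ s < d.
  have hie : hi < d by rewrite ltrDl.
  by split; apply: (le_lt_trans _ hie); rewrite le_max lexx ?orbT.
have intf x y : c <= x -> y <= d ->
    (@lebesgue_measure R).-integrable `[x, y] (EFin \o f).
  move=> cx yd; apply: continuous_compact_integrable.
    exact: segment_compact.
  apply: continuous_in_subspaceT => t; rewrite inE /= in_itv /= => /andP[xt ty].
  by apply: fI; apply: (cI _ _ Ic Id); rewrite (le_trans cx) //= (le_trans ty).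
(* A base point c to the left of a and s serves both orientations. *)
pose G t := \int[lebesgue_measure]_(u in `[c, t]) f u.
have GE t : c < t -> t < d -> oriented_integral a t f = G t - G a.
  move=> ct td; rewrite /oriented_integral /G; case: leP => at_.
    rewrite Rintegral_itvB ?bnd_simp //; [|exact/intf/ltW|exact: ltW].
    rewrite Rintegral_itv_obnd_cbnd //.
    by apply: integrableS (intf _ _ (ltW ca) (ltW td)) => //; exact: subset_itv_oc_cc.
  rewrite -[RHS]opprB Rintegral_itvB ?bnd_simp //; [|exact/intf/ltW|exact: ltW|exact: ltW].
  rewrite Rintegral_itv_obnd_cbnd //.
  by apply: integrableS (intf _ _ (ltW ct) (ltW ad)) => //; exact: subset_itv_oc_cc.
apply: (@near_eq_is_derive _ _ _ (fun t => G t - G a)).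
  near=> t; rewrite GE //; near: t.
    exact: lt_nbhsr.
  exact: lt_nbhsl.
have [dG G'] := continuous_FTC1_closed sd (intf _ _ (lexx c) (lexx d)) cs (fI _ Is).
rewrite -[f s]subr0; apply: is_deriveB.
by rewrite -G' derive1E; exact: derivableP.
Unshelve. all: by end_near. Qed.

End Calculus.

(** * Systems of polynomial differential equations *)

Section PolynomialFamilies.
Variable R : realType.

(** The algebra of functions generated by the constants and by the set [G]. *)
Inductive polynomial_in (T : Type) (G : set (T -> R)) : (T -> R) -> Prop :=
| polynomial_in_cst c : polynomial_in G (fun=> c)
| polynomial_in_gen f : G f -> polynomial_in G f
| polynomial_in_add f g : polynomial_in G f -> polynomial_in G g ->
    polynomial_in G (fun t => f t + g t)
| polynomial_in_mul f g : polynomial_in G f -> polynomial_in G g ->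
    polynomial_in G (fun t => f t * g t).

Lemma polynomial_in_sum (T : Type) (G : set (T -> R)) n (f : 'I_n -> T -> R) :
  (forall i, polynomial_in G (f i)) ->
  polynomial_in G (fun t => \sum_(i < n) f i t).
Proof.
elim: n f => [|n IH] f fG.
  by under eq_fun do rewrite big_ord0; exact: polynomial_in_cst.
under eq_fun do rewrite big_ord_recr /=.
by apply: polynomial_in_add => //; apply: IH.
Qed.

Lemma polynomial_in_opp (T : Type) (G : set (T -> R)) f :
  polynomial_in G f -> polynomial_in G (fun t => - f t).
Proof.
move=> Gf; under eq_fun do rewrite -mulN1r.
by apply: polynomial_in_mul => //; exact: polynomial_in_cst.
Qed.

Lemma polynomial_in_exp (T : Type) (G : set (T -> R)) f n :
  polynomial_in G f -> polynomial_in G (fun t => f t ^+ n).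
Proof.
move=> Gf; elim: n => [|n IH]; first exact: polynomial_in_cst.
by under eq_fun do rewrite exprS; exact: polynomial_in_mul.
Qed.

Lemma polynomial_in_comp (T T' : Type) (G : set (T -> R)) (G' : set (T' -> R))
    (u : T' -> T) f :
  (forall g, G g -> G' (g \o u)) ->
  polynomial_in G f -> polynomial_in G' (f \o u).
Proof.
move=> GG'; elim=> [c|g /GG'|g h _ IHg _ IHh|g h _ IHg _ IHh].
- exact: polynomial_in_cst.
- exact: polynomial_in_gen.
- exact: polynomial_in_add.
- exact: polynomial_in_mul.
Qed.

(** On [U], the members of [G] are differentiable and their directional
    derivatives are polynomials in the members of [G]: a system of polynomial
    differential equations. *)
Definition differentially_closed (V : normedModType R) (U : set V)
    (G : set (V -> R)) : Prop :=
  forall f, G f -> (forall p, U p -> differentiable f p) /\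
    forall v, exists2 g, polynomial_in G g &
      forall p, U p -> is_derive p v f (g p).

Section Closed.
Variables (V : normedModType R) (U : set V) (G : set (V -> R)).
Hypothesis GU : differentially_closed U G.

Lemma polynomial_in_differentiable f p :
  polynomial_in G f -> U p -> differentiable f p.
Proof.
move=> Gf Up; elim: Gf => [c|g /GU[+ _]|g h _ dg _ dh|g h _ dg _ dh].
- exact: differentiable_cst.
- exact.
- exact: differentiableD.
- exact: differentiableM.
Qed.

Lemma polynomial_in_derive f v : polynomial_in G f ->
  exists2 g, polynomial_in G g & forall p, U p -> is_derive p v f (g p).
Proof.
elim=> [c|g /GU[_]|g h Gg [g' Gg' dg] Gh [h' Gh' dh]|
        g h Gg [g' Gg' dg] Gh [h' Gh' dh]].
- by exists (fun=> 0) => [|p _]; [exact: polynomial_in_cst|exact: is_derive_cst].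
- exact.
- exists (fun p => g' p + h' p) => [|p Up]; first exact: polynomial_in_add.
  by apply: is_deriveD; [exact: dg|exact: dh].
- exists (fun p => g p * h' p + h p * g' p) => [|p Up].
    by apply: polynomial_in_add; exact: polynomial_in_mul.
  by apply: (is_deriveM (dg p Up) (dh p Up)).
Qed.

End Closed.

Lemma is_derive_row (V : normedModType R) N (F : V -> 'rV[R]_N) p v
    (D : 'rV[R]_N) :
  (forall i, is_derive p v (fun q => F q 0 i) (D 0 i)) -> is_derive p v F D.
Proof.
move=> dF; have dFp : derivable F p v.
  by apply/derivable_mxP => i j; rewrite ord1; have [] := dF j.
apply: DeriveDef => //; rewrite derive_mx //; apply/rowP => i.
by rewrite !mxE; have [_ <-] := dF i.
Qed.

Lemma differentiable_row (V : normedModType R) N (F : V -> 'rV[R]_N) p :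
  (forall i, differentiable (fun q => F q 0 i) p) -> differentiable F p.
Proof.
move=> dF.
have -> : F = \sum_(i < N) (fun q => F q 0 i *: delta_mx 0 i).
  by apply/funext => q; rewrite fct_sumE [LHS]row_sum_delta.
by apply: differentiable_sum => i; exact: differentiableZl.
Qed.

Lemma near_eq_differentiable (V W : normedModType R) (f g : V -> W) (x : V) :
  {near x, f =1 g} -> differentiable f x -> differentiable g x.
Proof.
move=> fg df; have [dc /eqaddoP df0] := (diff_locallyP x f).1 df.
have fg0 : \forall y \near 0, f (y + x) = g (y + x).
  have := fg; rewrite /= (near_shift 0) /=.
  by apply: filterS => y /=; rewrite subr0.
have dg0 : g \o shift x = cst (g x) + 'd f x +o_ 0 id.
  apply/eqaddoP => e e0; apply: filterS2 (df0 e e0) fg0 => y /= + fgy.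
  by rewrite /= !fctE /= -fgy -(nbhs_singleton fg).
by apply/diff_locallyP; rewrite (diff_unique dc dg0).
Qed.

(** A function whose coordinates are polynomials in a differentially closed
    family is smooth, because its directional derivatives have the same form. *)
Lemma smooth_on_polynomial d N (U : set 'rV[R]_d) (G : set ('rV[R]_d -> R))
    (F : 'rV[R]_d -> 'rV[R]_N) :
  open U -> differentially_closed U G ->
  (forall i, exists2 f, polynomial_in G f & forall p, U p -> F p 0 i = f p) ->
  smooth_on U F.
Proof.
move=> oU GU FG vs.
set D := foldr _ _ _.
have near_eq (f g : 'rV[R]_d -> R) p : U p -> (forall q, U q -> f q = g q) ->
    {near p, f =1 g}.
  by move=> Up fg; apply: filterS (open_nbhs_nbhs (conj oU Up)) => q; exact: fg.
have DG i : exists2 f, polynomial_in G f & forall p, U p -> D p 0 i = f p.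
  rewrite {}/D; elim: vs i => [|v vs IH] i //=.
  have /choice[f /all_and2[Gf Df]] :
      forall i, exists f, polynomial_in G f /\ _ := fun i =>
        let: ex_intro2 f h1 h2 := IH i in ex_intro _ f (conj h1 h2).
  have /choice[g /all_and2[Gg dg]] : forall j, exists g, polynomial_in G g /\
      forall p, U p -> is_derive p v (f j) (g p).
    move=> j; have [g ? ?] := polynomial_in_derive GU v (Gf j).
    by exists g.
  exists (g i) => // p Up.
  set D := foldr _ _ _ in Df *.
  suff [_ ->] : is_derive p v D (\row_j g j p) by rewrite mxE.
  apply: is_derive_row => j; rewrite mxE.
  apply: near_eq_is_derive (dg j p Up).
  by apply: near_eq => // q Uq; rewrite Df.
move=> p Up; apply: differentiable_row => i.
have [f Gf Df] := DG i.
apply: near_eq_differentiable (polynomial_in_differentiable GU Gf Up).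
by apply: near_eq => // q Uq; rewrite Df.
Qed.

Section Pullback.
Variables (d : nat) (k : 'I_d) (I : set R) (H : set (R -> R)).

Lemma is_derive_coord (p v : 'rV[R]_d) i :
  is_derive p v (fun q : 'rV[R]_d => q 0 i) (v 0 i).
Proof.
have [dp Dp] := is_derive_id p v.
have -> : v 0 i = 'D_v (fun q : 'rV[R]_d => q 0 i) p.
  by rewrite -{1}Dp derive_mx // mxE.
by apply: derivableP; exact: diff_derivable (differentiable_coord _ _ _).
Qed.

Lemma is_derive_comp_coord (h : R -> R) (p v : 'rV[R]_d) dh :
  is_derive (p 0 k) 1 h dh ->
  is_derive p v (fun q : 'rV[R]_d => h (q 0 k)) (v 0 k * dh).
Proof.
move=> [/derivable1_diffP dfh <-].
have dc := differentiable_coord p 0 k.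
have dhc : differentiable (h \o (fun q : 'rV[R]_d => q 0 k)) p.
  exact: differentiable_comp.
apply: DeriveDef; first exact: diff_derivable.
rewrite (deriveE _ dhc) diff_comp //= -(deriveE _ dc).
have [_ ->] := is_derive_coord p v k.
by rewrite deriv1E ?derive1E //; exact/derivable1_diffP.
Qed.

(** The coordinates, together with the members of [H] evaluated at the [k]-th
    coordinate. *)
Definition coordinate_family : set ('rV[R]_d -> R) :=
  [set f : 'rV[R]_d -> R | (exists i, f = fun p : 'rV[R]_d => p 0 i) \/
     (exists2 h, H h & f = fun p : 'rV[R]_d => h (p 0 k))].

Lemma differentially_closed_coordinate :
  (forall h, H h -> exists2 h', polynomial_in H h' &
     forall s, I s -> is_derive s 1 h (h' s)) ->
  differentially_closed [set p : 'rV[R]_d | I (p 0 k)] coordinate_family.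
Proof.
move=> HI f [[i ->]|[h Hh ->]]; split=> [p Ip|v].
- exact: differentiable_coord.
- exists (fun=> v 0 i) => [|p _]; first exact: polynomial_in_cst.
  exact: is_derive_coord.
- have [h' _ dh] := HI h Hh; have [dp _] := dh _ Ip.
  apply: (@differentiable_comp _ _ _ _ (fun q : 'rV[R]_d => q 0 k) h).
    exact: differentiable_coord.
  exact/derivable1_diffP.
- have [h' Hh' dh] := HI h Hh.
  exists (fun p : 'rV[R]_d => v 0 k * h' (p 0 k)) => [|p Ip].
    apply: polynomial_in_mul; first exact: polynomial_in_cst.
    apply: (@polynomial_in_comp _ _ H _ (fun p : 'rV[R]_d => p 0 k)) Hh'.
    by move=> g Hg; right; exists g.
  by apply: is_derive_comp_coord; exact: dh.
Qed.

End Pullback.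

End PolynomialFamilies.

(* [leaf] recognizes the generators. *)
Ltac polynomial_step leaf :=
  first [ apply polynomial_in_cst | leaf tt
        | apply polynomial_in_mul | apply polynomial_in_add
        | apply polynomial_in_opp | apply polynomial_in_exp
        | apply polynomial_in_sum; intro ].

(** * Normal projection and mean curvature *)

Section Submanifold.
Variables (R : realType) (d N : nat).
Implicit Types (F : 'rV[R]_d -> 'rV[R]_N) (p : 'rV[R]_d).

Lemma dot_mulmx (u v : 'rV[R]_N) : dot u v = (u *m v^T) 0 0.
Proof. by rewrite mxE; apply: eq_bigr => i _; rewrite mxE. Qed.

Lemma dot_self_eq0 (u : 'rV[R]_N) : dot u u = 0 -> u = 0.
Proof.
move=> /eqP; rewrite psumr_eq0 => [|i _]; last exact: sqr_ge0.
move=> /allP u0; apply/rowP => i; rewrite mxE.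
by have /implyP/(_ isT) := u0 i (mem_index_enum _); rewrite mulf_eq0 orbb => /eqP.
Qed.

Lemma normal_tangent_cap0 F p :
  (normal_subspace F p :&: tangent_subspace F p = 0)%MS.
Proof.
apply/eqP; rewrite -submx0; apply/rV_subP => v.
rewrite sub_capmx genmxE => /andP[/sub_kermxP vJ /submxP[u vE]].
by rewrite submx0; apply/eqP/dot_self_eq0; rewrite dot_mulmx {2}vE trmx_mul mulmxA vJ
  mul0mx mxE.
Qed.

Lemma diff_sub_jacobian F p v : ('d F p v <= 'J F p)%MS.
Proof. by rewrite -[X in (X <= _)%MS](mul_rV_lin1 ('d F p)) submxMl. Qed.

(** The normal projection is linear and kills tangent vectors, so the trace of
    the second derivatives is only needed up to a tangent vector. *)
Lemma mean_curvature_eq F p v w :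
  \sum_(i < d) \sum_(j < d) invmx (induced_metric F p) i j *:
    'D_(delta_mx 0 i) ('D_(delta_mx 0 j) F) p = w + 'd F p v ->
  mean_curvature F p = normal_proj F p w.
Proof.
move=> Hw; transitivity (normal_proj F p (w + 'd F p v)).
  rewrite -Hw /normal_proj mulmx_suml; apply: eq_bigr => i _.
  by rewrite mulmx_suml; apply: eq_bigr => j _; rewrite -scalemxAl.
rewrite /normal_proj mulmxDl [X in _ + X](proj_mx_0 (normal_tangent_cap0 F p)) ?addr0 //.
by rewrite /tangent_subspace genmxE diff_sub_jacobian.
Qed.

End Submanifold.

(** * Vectors of C^(m+1) in real coordinates *)

Section ComplexVectors.
Variables (R : realType) (m : nat).
Implicit Types (f g : 'I_m -> R) (c : R).

Lemma sum_lift_max (V : zmodType) (h : 'I_m.+1 -> V) :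
  \sum_(i < m.+1) h i = \sum_(j < m) h (lift ord_max j) + h ord_max.
Proof. by rewrite (bigD1_ord ord_max) //= addrC. Qed.

Lemma ord_max_ind (Pr : 'I_m.+1 -> Prop) :
  (forall j, Pr (lift ord_max j)) -> Pr ord_max -> forall i, Pr i.
Proof. by move=> Pl Pm i; case: (unliftP ord_max i) => [j ->|->]. Qed.

Lemma lift_max_neq (j : 'I_m) : (lift ord_max j == ord_max) = false.
Proof. by rewrite eq_sym; apply/negbTE; exact: neq_lift. Qed.

(** The row with first entries [f] and last entry [c]. *)
Definition hrow f c : 'rV[R]_m.+1 :=
  \row_k (if unlift ord_max k is Some j then f j else c).

Lemma hrow_lift f c j : hrow f c 0 (lift ord_max j) = f j.
Proof. by rewrite mxE liftK. Qed.

Lemma hrow_max f c : hrow f c 0 ord_max = c.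
Proof. by rewrite mxE unlift_none. Qed.

(** The vector of C^(m+1), as a real vector, whose first entries are
    [a j + i b j] and whose last entry is [c + i e]. *)
Definition cvec (a b : 'I_m -> R) (c e : R) : 'rV[R]_(m.+1 + m.+1) :=
  row_mx (hrow a c) (hrow b e).

Lemma cvec_ind (Pr : 'I_(m.+1 + m.+1) -> Prop) :
  (forall j, Pr (lshift m.+1 (lift ord_max j))) -> Pr (lshift m.+1 ord_max) ->
  (forall j, Pr (rshift m.+1 (lift ord_max j))) -> Pr (rshift m.+1 ord_max) ->
  forall i, Pr i.
Proof.
move=> P1 P2 P3 P4 i; case: (splitP i) => j.
  by move=> /(@val_inj _ _ _ i (lshift _ j)) ->; elim/ord_max_ind: j.
by move=> /(@val_inj _ _ _ i (rshift _ j)) ->; elim/ord_max_ind: j.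
Qed.

Lemma cvecE a b c e :
  ((forall j, cvec a b c e 0 (lshift m.+1 (lift ord_max j)) = a j) *
   (cvec a b c e 0 (lshift m.+1 ord_max) = c)) *
  ((forall j, cvec a b c e 0 (rshift m.+1 (lift ord_max j)) = b j) *
   (cvec a b c e 0 (rshift m.+1 ord_max) = e)).
Proof.
by do !split=> *; rewrite ?row_mxEl ?row_mxEr ?hrow_lift ?hrow_max.
Qed.

Lemma dot_cvec a b c e a' b' c' e' :
  dot (cvec a b c e) (cvec a' b' c' e') =
  \sum_(j < m) (a j * a' j + b j * b' j) + c * c' + e * e'.
Proof.
rewrite /dot big_split_ord /= !sum_lift_max !cvecE big_split /=.
by under eq_bigr do rewrite !cvecE; under [X in _ + (X + _)]eq_bigr do rewrite !cvecE;
  ring.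
Qed.

Lemma cstruct_cvec a b c e :
  cstruct (cvec a b c e) = cvec (fun j => - b j) a (- e) c.
Proof.
rewrite /cstruct row_mxKl row_mxKr; congr row_mx; apply/rowP.
by elim/ord_max_ind => [j|]; rewrite !mxE ?liftK ?unlift_none.
Qed.

End ComplexVectors.

(** * The geometry of the tangent space at one point *)

Section PointwiseGeometry.
Variables (R : realType) (m : nat).
Variables (B b : R) (lam r rho C S x : 'I_m -> R).
Hypotheses (B0 : B != 0) (r_rho : forall j, r j * rho j = 1)
  (CS : forall j, C j ^+ 2 + S j ^+ 2 = 1).
Implicit Types u v : 'rV[R]_m.+1.

Let X (u : 'rV[R]_m.+1) (j : 'I_m) : R := u 0 (lift ord_max j).
Let Y (u : 'rV[R]_m.+1) : R := u 0 ord_max.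

(** The differential of the immersion at a point where the angles phi_j have
    cosine [C j] and sine [S j]: the partial derivative in the j-th variable is
    [r j * e_j - lam j * x j * e_n], the one in the last variable is
    [(B + i b) * (e_n + sum_j lam j * x j * rho j * e_j)]. *)
Definition dF v : 'rV[R]_(m.+1 + m.+1) := cvec
  (fun j => X v j * (r j * C j) + Y v * (x j * lam j * rho j * (B * C j - b * S j)))
  (fun j => X v j * (r j * S j) + Y v * (x j * lam j * rho j * (B * S j + b * C j)))
  (- (\sum_(j < m) lam j * x j * X v j) + Y v * B) (Y v * b).

(** The squared norm of the vector [e_n + sum_j lam j * x j * rho j * e_j]. *)
Definition norm2W : R := 1 + \sum_(j < m) (lam j * x j * rho j) ^+ 2.

Lemma norm2W_gt0 : 0 < norm2W.
Proof. by rewrite ltr_pwDl // sumr_ge0 // => j _; exact: sqr_ge0. Qed.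

Lemma norm2c_gt0 : 0 < B ^+ 2 + b ^+ 2.
Proof. by rewrite ltr_pwDl ?sqr_ge0 // exprn_even_gt0. Qed.

Lemma dot_dF u v : dot (dF u) (dF v) =
  \sum_(j < m) r j ^+ 2 * X u j * X v j
  + (\sum_(j < m) lam j * x j * X u j) * (\sum_(j < m) lam j * x j * X v j)
  + (B ^+ 2 + b ^+ 2) * norm2W * Y u * Y v.
Proof.
rewrite dot_cvec.
have term j : (X u j * (r j * C j) + Y u * (x j * lam j * rho j * (B * C j - b * S j))) *
    (X v j * (r j * C j) + Y v * (x j * lam j * rho j * (B * C j - b * S j))) +
    (X u j * (r j * S j) + Y u * (x j * lam j * rho j * (B * S j + b * C j))) *
    (X v j * (r j * S j) + Y v * (x j * lam j * rho j * (B * S j + b * C j))) =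
    r j ^+ 2 * X u j * X v j + lam j * x j * X u j * (Y v * B)
    + lam j * x j * X v j * (Y u * B)
    + (lam j * x j * rho j) ^+ 2 * ((B ^+ 2 + b ^+ 2) * Y u * Y v).
  transitivity ((C j ^+ 2 + S j ^+ 2) * (r j ^+ 2 * X u j * X v j
    + (r j * rho j) * (lam j * x j * X u j * (Y v * B))
    + (r j * rho j) * (lam j * x j * X v j * (Y u * B))
    + (lam j * x j * rho j) ^+ 2 * ((B ^+ 2 + b ^+ 2) * Y u * Y v))); first by ring.
  by rewrite CS r_rho !mul1r.
rewrite (eq_bigr _ (fun j _ => term j)) !big_split /= -!mulr_suml /norm2W.
ring.
Qed.

(** The last partial derivative is Hermitian orthogonal to the others, whose
    Hermitian products are real. *)
Lemma symplectic_dF u v : symplectic_form (dF u) (dF v) = 0.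
Proof.
rewrite /symplectic_form cstruct_cvec dot_cvec.
have term j : - (X u j * (r j * S j) + Y u * (x j * lam j * rho j * (B * S j + b * C j))) *
    (X v j * (r j * C j) + Y v * (x j * lam j * rho j * (B * C j - b * S j))) +
    (X u j * (r j * C j) + Y u * (x j * lam j * rho j * (B * C j - b * S j))) *
    (X v j * (r j * S j) + Y v * (x j * lam j * rho j * (B * S j + b * C j))) =
    lam j * x j * X u j * (Y v * b) - lam j * x j * X v j * (Y u * b).
  transitivity ((C j ^+ 2 + S j ^+ 2) * (r j * rho j) *
    (lam j * x j * X u j * (Y v * b) - lam j * x j * X v j * (Y u * b))); first by ring.
  by rewrite CS r_rho !mul1r.
rewrite (eq_bigr _ (fun j _ => term j)) sumrB -!mulr_suml.
ring.
Qed.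

Lemma dF_eq0 v : dF v = 0 -> v = 0.
Proof.
move=> dv0; have : dot (dF v) (dF v) = 0.
  by rewrite dv0 /dot big1 // => i _; rewrite mxE mul0r.
have N0 := norm2c_gt0; have w0 := norm2W_gt0.
have rn0 j : r j != 0.
  by apply: contraTneq (oner_neq0 R) => rj0; rewrite -(r_rho j) rj0 mul0r eqxx.
rewrite dot_dF.
have s1 : 0 <= \sum_(j < m) r j ^+ 2 * X v j * X v j.
  by apply: sumr_ge0 => j _; rewrite -mulrA -expr2 mulr_ge0 ?sqr_ge0.
have s2 := sqr_ge0 (\sum_(j < m) lam j * x j * X v j).
have s3 : 0 <= (B ^+ 2 + b ^+ 2) * norm2W * Y v * Y v.
  by rewrite -mulrA -expr2 mulr_ge0 ?sqr_ge0 // mulr_ge0 ?ltW.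
move=> /eqP; rewrite -expr2 !paddr_eq0 ?addr_ge0 // => /andP[/andP[/eqP Xv _]].
rewrite -mulrA -expr2 mulf_eq0 sqrf_eq0 mulf_eq0 (gt_eqF N0) (gt_eqF w0) /=.
move/eqP => Yv; apply/rowP; elim/ord_max_ind => [j|]; rewrite mxE //.
have Xj0 i : true -> 0 <= r i ^+ 2 * X v i * X v i.
  by move=> _; rewrite -mulrA -expr2 mulr_ge0 ?sqr_ge0.
have /eqP := psumr_eq0P Xj0 Xv (i := j) isT.
by rewrite -mulrA -expr2 mulf_eq0 !sqrf_eq0 (negbTE (rn0 j)) /= => /eqP.
Qed.

(** The inverse of the induced metric: the metric is block diagonal, and its
    block in the first variables is a rank one perturbation of a diagonal
    matrix. *)
Definition inv_metric : 'M[R]_m.+1 := \matrix_(i, k)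
  match unlift ord_max i, unlift ord_max k with
  | Some j, Some l => (j == l)%:R * rho j ^+ 2
      - (lam j * x j * rho j ^+ 2) * (lam l * x l * rho l ^+ 2) / norm2W
  | None, None => ((B ^+ 2 + b ^+ 2) * norm2W)^-1
  | _, _ => 0
  end.

Lemma delta_lift i j : X (delta_mx 0 (lift ord_max i)) j = (j == i)%:R.
Proof. by rewrite /X mxE eqxx /= (inj_eq lift_inj). Qed.

Lemma delta_max j : X (delta_mx 0 ord_max) j = 0.
Proof. by rewrite /X mxE eqxx /= lift_max_neq. Qed.

Lemma last_delta_lift i : Y (delta_mx 0 (lift ord_max i)) = 0.
Proof. by rewrite /Y mxE eqxx /= eq_sym lift_max_neq. Qed.

Lemma last_delta_max : Y (delta_mx 0 ord_max) = 1.
Proof. by rewrite /Y mxE !eqxx. Qed.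

Lemma sum_delta (f : 'I_m -> R) i : \sum_(j < m) f j * (j == i)%:R = f i.
Proof.
rewrite (bigD1 i) //= eqxx mulr1 big1 ?addr0 // => j /negbTE ->.
by rewrite mulr0.
Qed.

Lemma sum_delta_lift (f : 'I_m -> R) i :
  \sum_(j < m) f j * X (delta_mx 0 (lift ord_max i)) j = f i.
Proof. by under eq_bigr do rewrite delta_lift; exact: sum_delta. Qed.

Lemma sum_delta_max (f : 'I_m -> R) :
  \sum_(j < m) f j * X (delta_mx 0 ord_max) j = 0.
Proof. by rewrite big1 // => j _; rewrite delta_max mulr0. Qed.

Lemma inv_metricP (g : 'M[R]_m.+1) :
  (forall i k, g i k = dot (dF (delta_mx 0 i)) (dF (delta_mx 0 k))) ->
  invmx g = inv_metric.
Proof.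
move=> gE.
have w0 : norm2W != 0 by rewrite gt_eqF ?norm2W_gt0.
have N0 : B ^+ 2 + b ^+ 2 != 0 by rewrite gt_eqF ?norm2c_gt0.
suff gG : g *m inv_metric = 1%:M.
  have [gU _] := mulmx1_unit gG.
  by rewrite -[RHS](mulKmx gU) gG mulmx1.
have gxx i k : g (lift ord_max i) (lift ord_max k) =
    (i == k)%:R * r i ^+ 2 + lam i * x i * (lam k * x k).
  rewrite gE dot_dF !last_delta_lift !mulr0 addr0.
  rewrite !sum_delta_lift delta_lift eq_sym.
  by case: eqVneq => [->|_]; rewrite ?(mulr1, mul1r) // mulr0 mul0r.
have gxs i : g (lift ord_max i) ord_max = 0.
  by rewrite gE dot_dF last_delta_lift !sum_delta_max !(mulr0, mul0r, addr0).
have gsx i : g ord_max (lift ord_max i) = 0.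
  rewrite gE dot_dF last_delta_lift sum_delta_lift delta_max sum_delta_max.
  by rewrite !(mulr0, mul0r, addr0).
have gss : g ord_max ord_max = (B ^+ 2 + b ^+ 2) * norm2W.
  by rewrite gE dot_dF last_delta_max !sum_delta_max !(mulr0, add0r, mulr1).
apply/matrixP; elim/ord_max_ind => [i|]; elim/ord_max_ind => [k|];
  rewrite mxE [RHS]mxE sum_lift_max ?gxs ?gss.
- rewrite mul0r addr0 (inj_eq lift_inj).
  pose kk := lam k * x k * rho k ^+ 2.
  have term j : g (lift ord_max i) (lift ord_max j)
      * inv_metric (lift ord_max j) (lift ord_max k) =
      ((i == j)%:R * r i ^+ 2 * rho j ^+ 2) * (j == k)%:R
      - (r i ^+ 2 * (lam j * x j * rho j ^+ 2) * (kk / norm2W)) * (j == i)%:R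
      + (lam i * x i * (lam j * x j * rho j ^+ 2)) * (j == k)%:R
      - (lam j * x j * rho j) ^+ 2 * (lam i * x i * (kk / norm2W)).
    by rewrite gxx mxE !liftK [j == i]eq_sym /kk; ring.
  rewrite (eq_bigr _ (fun j _ => term j)) !(sumrB, big_split) /= !sum_delta -mulr_suml.
  have -> : \sum_(j < m) (lam j * x j * rho j) ^+ 2 = norm2W - 1 by rewrite /norm2W; ring.
  have rr j : r j ^+ 2 * rho j ^+ 2 = 1 by rewrite -exprMn r_rho expr1n.
  have -> : (i == k)%:R * r i ^+ 2 * rho k ^+ 2 = (i == k)%:R.
    by case: eqVneq => [->|_]; rewrite ?mul0r // mul1r rr.
  have -> : r i ^+ 2 * (lam i * x i * rho i ^+ 2) * (kk / norm2W) =
      lam i * x i * (kk / norm2W).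
    by rewrite -[in RHS](mul1r (lam i)) -(rr i); ring.
  by rewrite -/kk; field.
- rewrite mul0r addr0 lift_max_neq big1 // => j _.
  by rewrite mxE liftK unlift_none mulr0.
- rewrite big1 => [|j _]; last by rewrite gsx mul0r.
  by rewrite mxE liftK unlift_none mulr0 addr0 eq_sym lift_max_neq.
- rewrite big1 => [|j _]; last by rewrite gsx mul0r.
  by rewrite mxE unlift_none add0r eqxx mulfV // mulf_neq0.
Qed.

Lemma trace_inv_metric (V : lmodType R) (h : 'I_m.+1 -> 'I_m.+1 -> V) :
  \sum_(i < m.+1) \sum_(k < m.+1) inv_metric i k *: h i k =
  \sum_(j < m) \sum_(l < m)
    inv_metric (lift ord_max j) (lift ord_max l) *: h (lift ord_max j) (lift ord_max l)
  + ((B ^+ 2 + b ^+ 2) * norm2W)^-1 *: h ord_max ord_max.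
Proof.
rewrite sum_lift_max; congr (_ + _).
  apply: eq_bigr => j _; rewrite sum_lift_max [X in _ + X *: _]mxE.
  by rewrite liftK unlift_none scale0r addr0.
rewrite sum_lift_max big1 => [|j _].
  by rewrite add0r [X in X *: _]mxE unlift_none.
by rewrite mxE liftK unlift_none scale0r.
Qed.

(* [db] stands for the derivative of [b] in the last variable. *)
Variables (db sigma alpha : R).
Hypotheses (sigmaE : sigma = \sum_(j < m) lam j * rho j ^+ 2)
  (dbE : B * db = - (sigma + alpha) * b * (B ^+ 2 + b ^+ 2)).

(** The second differential of the immersion at a point, in the directions [u]
    and [v]. *)
Definition d2F u v : 'rV[R]_(m.+1 + m.+1) := cvec
  (fun j => (X v j * Y u + Y v * X u j) * (lam j * rho j * (B * C j - b * S j))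
     - Y v * Y u * x j * (lam j ^+ 2 * rho j ^+ 3 * (B ^+ 2 + b ^+ 2) * C j
                          + lam j * rho j * db * S j))
  (fun j => (X v j * Y u + Y v * X u j) * (lam j * rho j * (B * S j + b * C j))
     - Y v * Y u * x j * (lam j ^+ 2 * rho j ^+ 3 * (B ^+ 2 + b ^+ 2) * S j
                          - lam j * rho j * db * C j))
  (- (\sum_(j < m) lam j * X u j * X v j)) (Y v * Y u * db).

(** The direction whose image under [dF] is the difference of the trace of the
    second differential and [(0, ..., 0, alpha)]. Its entries are found by reducing
    that difference modulo the partial derivatives: each [e_j] becomes a real
    multiple of [e_n], and [i W] a real combination of [d_s F] and [W]. *)
Definition tangent_part : 'rV[R]_m.+1 :=
  hrow (fun j => lam j * x j * rho j ^+ 2 / norm2W * (sigma + alpha - lam j * rho j ^+ 2))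
    (- (sigma + alpha) / (norm2W * B)).

Lemma trace_d2F :
  \sum_(i < m.+1) \sum_(k < m.+1)
    inv_metric i k *: d2F (delta_mx 0 i) (delta_mx 0 k) =
  cvec (fun=> 0) (fun=> 0) alpha 0 + dF tangent_part.
Proof.
have w0 : norm2W != 0 by rewrite gt_eqF ?norm2W_gt0.
have N0 : B ^+ 2 + b ^+ 2 != 0 by rewrite gt_eqF ?norm2c_gt0.
have dbE' : db = - (sigma + alpha) * b * (B ^+ 2 + b ^+ 2) / B by rewrite -dbE mulrAC mulfV ?mul1r.
rewrite trace_inv_metric.
have d2s : d2F (delta_mx 0 ord_max) (delta_mx 0 ord_max) = cvec
    (fun j => - (x j * (lam j ^+ 2 * rho j ^+ 3 * (B ^+ 2 + b ^+ 2) * C j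
                        + lam j * rho j * db * S j)))
    (fun j => - (x j * (lam j ^+ 2 * rho j ^+ 3 * (B ^+ 2 + b ^+ 2) * S j
                        - lam j * rho j * db * C j))) 0 db.
  apply/rowP; elim/cvec_ind => [j||j|]; rewrite !cvecE ?last_delta_max ?delta_max.
  - by ring.
  - by rewrite sum_delta_max oppr0.
  - by ring.
  - by ring.
have d2x j l : d2F (delta_mx 0 (lift ord_max j)) (delta_mx 0 (lift ord_max l)) =
    cvec (fun=> 0) (fun=> 0) (- (lam l * (l == j)%:R)) 0.
  apply/rowP; elim/cvec_ind => [i||i|]; rewrite !cvecE ?last_delta_lift.
  - by ring.
  - by rewrite sum_delta_lift delta_lift.
  - by ring.
  - by ring.
have -> : \sum_(j < m) \sum_(l < m)
    inv_metric (lift ord_max j) (lift ord_max l) *: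
      d2F (delta_mx 0 (lift ord_max j)) (delta_mx 0 (lift ord_max l)) =
    cvec (fun=> 0) (fun=> 0) (- \sum_(j < m) lam j * (rho j ^+ 2
      - (lam j * x j * rho j ^+ 2) ^+ 2 / norm2W)) 0.
  apply/rowP; elim/cvec_ind => [i||i|]; rewrite summxE !cvecE.
  - rewrite big1 // => j _; rewrite summxE big1 // => l _.
    by rewrite mxE d2x cvecE mulr0.
  - rewrite -sumrN; apply: eq_bigr => j _; rewrite summxE.
    transitivity (\sum_(l < m) - (inv_metric (lift ord_max j) (lift ord_max l) * lam l)
                   * (l == j)%:R).
      by apply: eq_bigr => l _; rewrite mxE d2x cvecE mulrN mulNr mulrA.
    by rewrite sum_delta mxE liftK eqxx /=; ring.
  - rewrite big1 // => j _; rewrite summxE big1 // => l _.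
    by rewrite mxE d2x cvecE mulr0.
  - rewrite big1 // => j _; rewrite summxE big1 // => l _.
    by rewrite mxE d2x cvecE mulr0.
have Xt j : X tangent_part j =
    lam j * x j * rho j ^+ 2 / norm2W * (sigma + alpha - lam j * rho j ^+ 2).
  exact: hrow_lift.
have Yt : Y tangent_part = - (sigma + alpha) / (norm2W * B) by exact: hrow_max.
have rr j : rho j ^+ 2 * r j = rho j by rewrite -[RHS]mulr1 -(r_rho j); ring.
rewrite d2s; apply/rowP; elim/cvec_ind => [j||j|];
  rewrite [LHS]mxE [RHS]mxE [X in _ + X = _]mxE !cvecE ?Xt Yt.
- rewrite dbE'.
  transitivity (- (x j * lam j ^+ 2 * rho j ^+ 3 * C j / norm2W)
    + x j * lam j * rho j * (sigma + alpha) * b * S j / (B * norm2W)).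
    by field; rewrite w0 B0 N0.
  transitivity (lam j * x j * (rho j ^+ 2 * r j) / norm2W
      * (sigma + alpha - lam j * rho j ^+ 2) * C j
   - (sigma + alpha) * (x j * lam j * rho j * (B * C j - b * S j)) / (norm2W * B)).
    by rewrite rr; field; rewrite w0 B0.
  by field; rewrite w0 B0.
- pose M := \sum_(j < m) lam j * (lam j * x j * rho j ^+ 2) ^+ 2.
  have -> : \sum_(j < m) lam j * (rho j ^+ 2 - (lam j * x j * rho j ^+ 2) ^+ 2 / norm2W)
      = sigma - M / norm2W.
    rewrite sigmaE /M mulr_suml -sumrB; apply: eq_bigr => j _; ring.
  have -> : \sum_(j < m) lam j * x j * X tangent_part j
      = (norm2W - 1) * ((sigma + alpha) / norm2W) - M / norm2W.
    rewrite /M [norm2W in norm2W - 1]/norm2W [1 + _]addrC addrK !mulr_suml -sumrB.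
    by apply: eq_bigr => j _; rewrite Xt; ring.
  by field; rewrite w0 B0.
- rewrite dbE'.
  transitivity (- (x j * lam j ^+ 2 * rho j ^+ 3 * S j / norm2W)
    - x j * lam j * rho j * (sigma + alpha) * b * C j / (B * norm2W)).
    by field; rewrite w0 B0 N0.
  transitivity (lam j * x j * (rho j ^+ 2 * r j) / norm2W
      * (sigma + alpha - lam j * rho j ^+ 2) * S j
   - (sigma + alpha) * (x j * lam j * rho j * (B * S j + b * C j)) / (norm2W * B)).
    by rewrite rr; field; rewrite w0 B0.
  by field; rewrite w0 B0.
- by rewrite dbE'; field; rewrite w0 B0 N0.
Qed.

End PointwiseGeometry.

(** * The immersion built on a solution of the differential equations *)

Section ScalarDerivatives.
Variables (R : realType) (V : normedModType R) (p v : V).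
Implicit Types f g : V -> R.

Lemma is_derive_add f g df dg : is_derive p v f df -> is_derive p v g dg ->
  is_derive p v (fun q => f q + g q) (df + dg).
Proof. by move=> ? ?; exact: is_deriveD. Qed.

Lemma is_derive_sub f g df dg : is_derive p v f df -> is_derive p v g dg ->
  is_derive p v (fun q => f q - g q) (df - dg).
Proof. by move=> ? ?; exact: is_deriveB. Qed.

Lemma is_derive_opp f df : is_derive p v f df ->
  is_derive p v (fun q => - f q) (- df).
Proof. by move=> ?; exact: is_deriveN. Qed.

Lemma is_derive_mul f g df dg : is_derive p v f df -> is_derive p v g dg ->
  is_derive p v (fun q => f q * g q) (f p * dg + g p * df).
Proof. by move=> ? ?; exact: (is_deriveM (f := f) (g := g)). Qed.

Lemma is_derive_const (c : R) : is_derive p v (fun=> c) 0.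
Proof. exact: is_derive_cst. Qed.

Lemma is_derive_bigsum n (f : 'I_n -> V -> R) df :
  (forall i, is_derive p v (f i) (df i)) ->
  is_derive p v (fun q => \sum_(i < n) f i q) (\sum_(i < n) df i).
Proof.
move=> fd; have -> : (fun q => \sum_(i < n) f i q) = \sum_(i < n) f i.
  by apply/funext => q; rewrite fct_sumE.
exact: is_derive_sum.
Qed.

End ScalarDerivatives.

(* [leaf] differentiates the functions that are not sums or products. *)
Ltac derive_step leaf :=
  first [ eapply is_derive_const | leaf tt
        | eapply is_derive_mul | eapply is_derive_add | eapply is_derive_sub
        | eapply is_derive_opp | eapply is_derive_bigsum; intro ].

Section Immersion.
Variables (R : realType) (m : nat) (B beta alpha K1 K2 : R) (lam : 'I_m -> R).
Variables (I : set R) (r rho C S : 'I_m -> R -> R) (P q th : R -> R).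
Hypotheses (I_open : open I) (B0 : B != 0) (beta2 : beta ^+ 2 = B ^+ 2).
Hypotheses (r_rho : forall j s, I s -> r j s * rho j s = 1)
  (CS : forall j s, C j s ^+ 2 + S j s ^+ 2 = 1)
  (Pq : forall s, I s -> P s * q s ^+ 2 = 1 + q s ^+ 2).

(* In these hypotheses [r], [rho], [C], [S], [P], [q] and [th] stand for r_j,
   1 / r_j, cos phi_j, sin phi_j, Q + 1, 1 / sqrt Q and the integral of q;
   [Pq] says that Q q^2 = 1. *)

(** [2 * B * sigma] is the logarithmic derivative of the product of the r_j^2. *)
Definition sigma s : R := \sum_(j < m) lam j * rho j s ^+ 2.
(** The derivative of [q], that is, - P' q^3 / 2. *)
Definition dq s : R := - (P s * B * (sigma s + alpha) * q s ^+ 3).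

Hypotheses
  (der_r : forall j s, I s -> is_derive s 1 (r j) (lam j * B * rho j s))
  (der_rho : forall j s, I s -> is_derive s 1 (rho j) (- (lam j * B * rho j s ^+ 3)))
  (der_C : forall j s, I s ->
     is_derive s 1 (C j) (- (S j s * (lam j * beta * rho j s ^+ 2 * q s))))
  (der_S : forall j s, I s ->
     is_derive s 1 (S j) (C j s * (lam j * beta * rho j s ^+ 2 * q s)))
  (der_P : forall s, I s -> is_derive s 1 P (2 * B * (sigma s + alpha) * P s))
  (der_q : forall s, I s -> is_derive s 1 q (dq s))
  (der_th : forall s, I s -> is_derive s 1 th (q s)).

Let U : set 'rV[R]_m.+1 := [set p | I (p 0 ord_max)].

(** The parametrization of the submanifold; [K1 + i K2] is the translation
    constant. *)
Definition immersion (p : 'rV[R]_m.+1) : 'rV[R]_(m.+1 + m.+1) :=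
  let s := p 0 ord_max in let x j := p 0 (lift ord_max j) in
  cvec (fun j => x j * r j s * C j s) (fun j => x j * r j s * S j s)
    (- (1 / 2) * (\sum_(j < m) lam j * (x j * x j)) + B * s + K1) (beta * th s + K2).

(** The directional derivative of [immersion] along [v], as a function of the
    point. *)
Definition dimmersion (v p : 'rV[R]_m.+1) : 'rV[R]_(m.+1 + m.+1) :=
  let s := p 0 ord_max in
  dF B (beta * q s) lam (r^~ s) (rho^~ s) (C^~ s) (S^~ s)
    (fun j => p 0 (lift ord_max j)) v.

Ltac leaf_rule _ :=
  first [ exact: is_derive_coord
        | eapply (is_derive_comp_coord (h := r _)); apply: der_r; assumption
        | eapply (is_derive_comp_coord (h := rho _)); apply: der_rho; assumption
        | eapply (is_derive_comp_coord (h := C _)); apply: der_C; assumption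
        | eapply (is_derive_comp_coord (h := S _)); apply: der_S; assumption
        | eapply (is_derive_comp_coord (h := q)); apply: der_q; assumption
        | eapply (is_derive_comp_coord (h := th)); apply: der_th; assumption ].

Lemma is_derive_immersion p v : U p -> is_derive p v immersion (dimmersion v p).
Proof.
move=> Up; have Ip : I (p 0 ord_max) by [].
have rho0 j : rho j (p 0 ord_max) != 0.
  by apply: contra_eq_neq (r_rho j Ip) => ->; rewrite mulr0 eq_sym oner_eq0.
have rE j : r j (p 0 ord_max) = (rho j (p 0 ord_max))^-1.
  by apply: (mulIf (rho0 j)); rewrite mulVf // r_rho.
apply: is_derive_row; elim/cvec_ind => [j||j|]; under eq_fun do rewrite cvecE;
  rewrite cvecE; apply: is_derive_eq; try (by repeat derive_step leaf_rule).
- by rewrite /= rE; field.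
- rewrite /= !(mulr0, addr0, add0r) [X in _ + X = _]mulrC; congr (_ + _).
  by rewrite mulr_sumr -sumrN; apply: eq_bigr => j _; field.
- by rewrite /= rE; field.
- by rewrite /=; ring.
Qed.

Lemma derive_immersion p v : U p -> 'D_v immersion p = dimmersion v p.
Proof. by move=> Up; have [] := is_derive_immersion v Up. Qed.

Lemma is_derive_dimmersion p u v : U p ->
  let s := p 0 ord_max in
  is_derive p u (dimmersion v) (d2F B (beta * q s) lam (rho^~ s) (C^~ s) (S^~ s)
    (fun j => p 0 (lift ord_max j)) (beta * dq s) u v).
Proof.
move=> Up s; have Ip : I s by [].
have rho0 j : rho j s != 0.
  by apply: contra_eq_neq (r_rho j Ip) => ->; rewrite mulr0 eq_sym oner_eq0.
have rE j : r j s = (rho j s)^-1 by apply: (mulIf (rho0 j)); rewrite mulVf // r_rho.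
apply: is_derive_row; elim/cvec_ind => [j||j|]; under eq_fun do rewrite cvecE;
  rewrite cvecE; apply: is_derive_eq; try (by repeat derive_step leaf_rule).
- by rewrite /= -/s rE; field.
- rewrite /= !(mulr0, addr0, add0r); congr (- _); apply: eq_bigr => j _; ring.
- by rewrite /= -/s rE; field.
- by rewrite /= -/s; ring.
Qed.

(** The functions of the last variable out of which [immersion] is built. *)
Inductive profile : (R -> R) -> Prop :=
| profile_r j : profile (r j)
| profile_rho j : profile (rho j)
| profile_C j : profile (C j)
| profile_S j : profile (S j)
| profile_P : profile P
| profile_q : profile q
| profile_th : profile th.

(** This is where the differential equations are seen to be polynomial. *)
Lemma profile_derive h : profile h -> exists2 h', polynomial_in profile h' &
  forall s, I s -> is_derive s 1 h (h' s).
Proof.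
have leaf h' : profile h' -> polynomial_in profile h' := @polynomial_in_gen _ _ _ h'.
case=> [j|j|j|j|||].
- exists (fun s => lam j * B * rho j s) => [|s]; last exact: der_r.
  by repeat polynomial_step ltac:(fun _ => apply: leaf; constructor).
- exists (fun s => - (lam j * B * rho j s ^+ 3)) => [|s]; last exact: der_rho.
  by repeat polynomial_step ltac:(fun _ => apply: leaf; constructor).
- exists (fun s => - (S j s * (lam j * beta * rho j s ^+ 2 * q s))) => [|s]; last exact: der_C.
  by repeat polynomial_step ltac:(fun _ => apply: leaf; constructor).
- exists (fun s => C j s * (lam j * beta * rho j s ^+ 2 * q s)) => [|s]; last exact: der_S.
  by repeat polynomial_step ltac:(fun _ => apply: leaf; constructor).
- exists (fun s => 2 * B * (sigma s + alpha) * P s) => [|s]; last exact: der_P.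
  rewrite /sigma.
  by repeat polynomial_step ltac:(fun _ => apply: leaf; constructor).
- exists dq => [|s]; last exact: der_q.
  rewrite /dq /sigma.
  by repeat polynomial_step ltac:(fun _ => apply: leaf; constructor).
- exists q => [|s]; last exact: der_th.
  by repeat polynomial_step ltac:(fun _ => apply: leaf; constructor).
Qed.

Lemma open_domain : open U.
Proof.
have cont : continuous (fun p : 'rV[R]_m.+1 => p 0 ord_max) by exact: coord_continuous.
by move/continuousP : cont; exact.
Qed.

Lemma smooth_immersion : smooth_on U immersion.
Proof.
apply: (smooth_on_polynomial open_domain
  (differentially_closed_coordinate profile_derive)) => i.
have leafx k : polynomial_in (coordinate_family ord_max profile)
    (fun p : 'rV[R]_m.+1 => p 0 k).
  by apply: polynomial_in_gen; left; exists k.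
have leafh h : profile h -> polynomial_in (coordinate_family ord_max profile)
    (fun p : 'rV[R]_m.+1 => h (p 0 ord_max)).
  by move=> ?; apply: polynomial_in_gen; right; exists h.
exists (fun p => immersion p 0 i) => //; elim/cvec_ind: i => [j||j|];
  under eq_fun do rewrite cvecE;
  by repeat polynomial_step ltac:(fun _ => first [apply: leafx | apply: leafh; constructor]).
Qed.

Lemma diff_immersion p v : U p -> 'd immersion p v = dimmersion v p.
Proof.
move=> Up; rewrite -deriveE ?derive_immersion //.
by have := smooth_immersion [::] Up.
Qed.

Lemma lagrangian_immersion : lagrangian_immersion_on U immersion.
Proof.
split; first split; first exact: smooth_immersion.
  move=> p Up u v duv; apply/eqP; rewrite -subr_eq0; apply/eqP.
  have dF0 : dimmersion (u - v) p = 0.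
    by rewrite -diff_immersion // linearB duv subrr.
  exact (dF_eq0 B0 (fun j => r_rho j Up) (fun j => CS j (p 0 ord_max)) dF0).
move=> p Up u v; rewrite !diff_immersion //.
by apply: symplectic_dF => [j|j]; [exact: r_rho|exact: CS].
Qed.

Lemma mean_curvature_immersion p : U p ->
  mean_curvature immersion p =
  normal_proj immersion p (cvec (fun=> 0) (fun=> 0) alpha 0).
Proof.
move=> Up; have Ip : I (p 0 ord_max) by [].
set s := p 0 ord_max in Ip.
have metricE i k : induced_metric immersion p i k =
    dot (dimmersion (delta_mx 0 i) p) (dimmersion (delta_mx 0 k) p).
  by rewrite mxE !diff_immersion.
have Dd2 u v : 'D_u ('D_v immersion) p = d2F B (beta * q s) lam (rho^~ s)
    (C^~ s) (S^~ s) (fun j => p 0 (lift ord_max j)) (beta * dq s) u v.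
  have [_ <-] := is_derive_dimmersion u v Up.
  apply: near_eq_derive; apply: filterS (open_nbhs_nbhs (conj open_domain Up)).
  by move=> p' Up'; rewrite derive_immersion.
apply: mean_curvature_eq; rewrite diff_immersion //.
rewrite (inv_metricP B0 (fun j => r_rho j Ip) (fun j => CS j _) metricE).
under eq_bigr do under eq_bigr do rewrite Dd2.
apply: trace_d2F => //.
  by move=> j; exact: r_rho.
rewrite exprMn beta2 /dq -/(sigma s).
have -> : B ^+ 2 + B ^+ 2 * q s ^+ 2 = B ^+ 2 * (P s * q s ^+ 2) by rewrite Pq //; ring.
ring.
Qed.

End Immersion.

(** * The explicit solution *)

Section Profiles.
Variable R : realType.

Lemma is_derive_continuous (f : R -> R) (s df : R) :
  is_derive s 1 f df -> {for s, continuous f}.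
Proof.
by move=> [/derivable1_diffP fs _]; exact: differentiable_continuous.
Qed.

(** A product of functions is differentiated through its logarithmic
    derivatives [g k]. *)
Lemma is_derive_prod n (f g : 'I_n -> R -> R) (s : R) :
  (forall k, is_derive s 1 (f k) (f k s * g k s)) ->
  is_derive s 1 (fun t => \prod_(k < n) f k t)
    ((\prod_(k < n) f k s) * \sum_(k < n) g k s).
Proof.
elim: n f g => [|n IH] f g df.
  under eq_fun do rewrite big_ord0.
  by rewrite !big_ord0 mulr0; exact: is_derive_const.
under eq_fun do rewrite big_ord_recr /=.
have IHn := IH (fun k => f (widen_ord (leqnSn n) k))
  (fun k => g (widen_ord (leqnSn n) k)) (fun k => df _).
apply: is_derive_eq (is_derive_mul IHn (df ord_max)) _.
by rewrite !big_ord_recr /=; ring.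
Qed.

Lemma is_derive_affine (c e s : R) : is_derive s 1 (fun t => c + e * t) e.
Proof.
apply: is_derive_eq (is_derive_add (is_derive_const s 1 c)
  (is_derive_mul (is_derive_const s 1 e) (is_derive_id s 1))) _.
by rewrite /=; ring.
Qed.

Lemma is_derive_sqrt_comp (f : R -> R) (s df : R) : 0 < f s ->
  is_derive s 1 f df ->
  is_derive s 1 (fun t => Num.sqrt (f t)) (df / (2 * Num.sqrt (f s))).
Proof.
move=> fs0 fs; rewrite mulrC.
exact: (is_derive1_comp (f := Num.sqrt) (is_derive1_sqrt fs0)).
Qed.

Lemma is_derive_inv_comp (f : R -> R) (s df : R) : f s != 0 ->
  is_derive s 1 f df ->
  is_derive s 1 (fun t => (f t)^-1) (- (df * (f s)^-1 ^+ 2)).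
Proof.
move=> fs0 fs; apply: is_derive_eq (is_deriveV fs0 fs) _.
by rewrite -[LHS]/(- (f s) ^- 2 * df) exprVn; ring.
Qed.

End Profiles.

(* Here n = m + 1. A parameter p : 'rV_(m.+1) stands for ((x_j)_j, s): its last
   coordinate p 0 ord_max is s, and x_j is p 0 (lift ord_max j). *)
Theorem theorem1p4 (R : realType) (m : nat) (hm : (0 < m)%N)
    (B E alpha : R) (lam a psi : 'I_m -> R) (K : R[i])
    (hB : B != 0) (hlam : forall j, lam j != 0) (hE : 1 < E)
    (ha : forall j, 0 < a j)
    (I : set R) (I_open : open I) (I_connected : connected I) (I0 : I 0)
    (hI1 : forall s, I s ->
       0 < E * (\prod_(k < m) (1 + 2 * a k * B * lam k * s))
             * expR (2 * B * alpha * s) - 1)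
    (hI2 : forall j s, I s -> 0 < 1 / a j + 2 * lam j * B * s) :
  let Q (t : R) : R :=
    E * (\prod_(k < m) (1 + 2 * a k * B * lam k * t))
      * expR (2 * B * alpha * t) - 1 in
  let r (j : 'I_m) (s : R) : R := Num.sqrt (1 / a j + 2 * lam j * B * s) in
  let phi (j : 'I_m) (s : R) : R :=
    psi j + oriented_integral 0 s (fun t =>
      lam j * `|B| / ((1 / a j + 2 * lam j * B * t) * Num.sqrt (Q t))) in
  let zn (x : 'I_m -> R) (s : R) : R[i] :=
    ((- (1 / 2) * (\sum_(j < m) lam j * x j ^+ 2) + B * s)
      +i* (`|B| * oriented_integral 0 s (fun t => 1 / Num.sqrt (Q t)))) + K in
  let L (p : 'rV[R]_m.+1) : 'rV[R[i]]_m.+1 :=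
    let x j := p 0 (lift ord_max j) in
    let s := p 0 ord_max in
    \row_(k < m.+1)
      if unlift ord_max k is Some j
      then (x j)%:C * (r j s)%:C * expi (phi j s)
      else zn x s in
  let F (p : 'rV[R]_m.+1) : 'rV[R]_(m.+1 + m.+1) := realify (L p) in
  let U : set 'rV[R]_m.+1 := [set p : 'rV[R]_m.+1 | I (p 0 ord_max)] in
  let T : 'rV[R[i]]_m.+1 :=
    \row_(k < m.+1) (if k == ord_max then alpha%:C else 0) in
  lagrangian_immersion_on U F /\
  forall p, U p -> mean_curvature F p = normal_proj F p (realify T).
Proof.
move=> Q r phi zn L F U T.
pose rho (j : 'I_m) (s : R) : R := (r j s)^-1.
pose C (j : 'I_m) (s : R) : R := cos (phi j s).
pose S (j : 'I_m) (s : R) : R := sin (phi j s).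
pose P (s : R) : R := Q s + 1.
pose q (s : R) : R := (Num.sqrt (Q s))^-1.
pose th (s : R) : R := oriented_integral 0 s (fun t => 1 / Num.sqrt (Q t)).
have Q0 s : I s -> 0 < Q s by exact: hI1.
have r20 j s : I s -> 0 < 1 / a j + 2 * lam j * B * s by exact: hI2.
have r0 j s : I s -> r j s != 0 by move=> Is; rewrite gt_eqF // sqrtr_gt0 r20.
have sQ0 s : I s -> Num.sqrt (Q s) != 0.
  by move=> Is; rewrite gt_eqF // sqrtr_gt0 Q0.
have rE j s : I s -> r j s ^+ 2 = 1 / a j + 2 * lam j * B * s.
  by move=> Is; rewrite sqr_sqrtr // ltW // r20.
have qE s : I s -> q s ^+ 2 = (Q s)^-1.
  by move=> Is; rewrite exprVn sqr_sqrtr // ltW // Q0.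
have der_r j s : I s -> is_derive s 1 (r j) (lam j * B * rho j s).
  move=> Is; have d := is_derive_sqrt_comp
    (f := fun t => 1 / a j + 2 * lam j * B * t) (r20 j s Is) (is_derive_affine _ _ s).
  apply: is_derive_eq d _.
  by rewrite /rho -/(r j s); field; rewrite r0.
have der_rho j s : I s -> is_derive s 1 (rho j) (- (lam j * B * rho j s ^+ 3)).
  move=> Is; apply: is_derive_eq (is_derive_inv_comp (r0 j s Is) (der_r j s Is)) _.
  by rewrite -/(rho j s); ring.
have der_P s : I s ->
    is_derive s 1 P (2 * B * (sigma lam rho s + alpha) * P s).
  move=> Is.
  have dprod : is_derive s 1 (fun t => \prod_(k < m) (1 + 2 * a k * B * lam k * t))
      ((\prod_(k < m) (1 + 2 * a k * B * lam k * s)) * \sum_(k < m) 2 * B * (lam k * rho k s ^+ 2)).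
    apply: (is_derive_prod (g := fun k s => 2 * B * (lam k * rho k s ^+ 2))) => k.
    apply: is_derive_eq (is_derive_affine _ _ _) _.
    have ak0 : a k != 0 by rewrite gt_eqF.
    (* The factors of Q + 1 are a_k r_k^2. *)
    have -> : 1 + 2 * a k * B * lam k * s = a k * r k s ^+ 2 by rewrite rE //; field.
    by rewrite /rho; field; rewrite r0.
  have dexp : is_derive s 1 (fun t => expR (2 * B * alpha * t))
      (expR (2 * B * alpha * s) * (2 * B * alpha)).
    have de : is_derive s 1 (fun t => 2 * B * alpha * t) (2 * B * alpha).
      apply: is_derive_eq (is_derive_mul (is_derive_const s 1 _) (is_derive_id s 1)) _.
      by rewrite /=; ring.
    exact: (is_derive1_comp (f := expR) (is_derive_expR _) de).
  have -> : P = fun t => E * (\prod_(k < m) (1 + 2 * a k * B * lam k * t))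
      * expR (2 * B * alpha * t).
    by apply/funext => t; rewrite /P /Q subrK.
  apply: is_derive_eq (is_derive_mul (is_derive_mul (is_derive_const s 1 E) dprod) dexp) _.
  by rewrite /= /sigma -mulr_sumr; ring.
have der_Q s : I s -> is_derive s 1 Q (2 * B * (sigma lam rho s + alpha) * P s).
  move=> Is; have -> : Q = fun t => P t - 1 by apply/funext => t; rewrite /P addrK.
  apply: is_derive_eq (is_derive_sub (der_P s Is) (is_derive_const s 1 1)) _.
  by rewrite subr0.
have der_q s : I s -> is_derive s 1 q (dq B alpha lam rho P q s).
  move=> Is; have d := is_derive_inv_comp (f := fun t => Num.sqrt (Q t)) (sQ0 s Is)
    (is_derive_sqrt_comp (Q0 s Is) (der_Q s Is)).
  apply: is_derive_eq d _.
  by rewrite /dq /q; field; rewrite sQ0.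
have der_th s : I s -> is_derive s 1 th (q s).
  move=> Is; have -> : th = fun t => oriented_integral 0 t q.
    by apply/funext => t; congr oriented_integral; apply/funext => u; rewrite div1r.
  apply: (is_derive_oriented_integral I_open I_connected _ I0 Is) => t It.
  exact: is_derive_continuous (der_q t It).
have der_phi j s : I s -> is_derive s 1 (phi j) (lam j * `|B| * rho j s ^+ 2 * q s).
  move=> Is; have dint : is_derive s 1 (fun s => oriented_integral 0 s (fun t =>
      lam j * `|B| / ((1 / a j + 2 * lam j * B * t) * Num.sqrt (Q t))))
      (lam j * `|B| / ((1 / a j + 2 * lam j * B * s) * Num.sqrt (Q s))).
    apply: (is_derive_oriented_integral I_open I_connected _ I0 Is) => t It.
    have d1 := is_derive_mul (is_derive_affine (1 / a j) (2 * lam j * B) t)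
      (is_derive_sqrt_comp (Q0 t It) (der_Q t It)).
    have n0 : (1 / a j + 2 * lam j * B * t) * Num.sqrt (Q t) != 0.
      by rewrite mulf_neq0 ?sQ0 // gt_eqF // r20.
    exact (is_derive_continuous
      (is_derive_mul (is_derive_const t 1 (lam j * `|B|)) (is_derive_inv_comp
        (f := fun u => (1 / a j + 2 * lam j * B * u) * Num.sqrt (Q u)) n0 d1))).
  apply: is_derive_eq (is_derive_add (is_derive_const s 1 (psi j)) dint) _.
  rewrite add0r -rE // /rho /q; field.
  by rewrite r0 // sQ0.
have der_C j s : I s ->
    is_derive s 1 (C j) (- (S j s * (lam j * `|B| * rho j s ^+ 2 * q s))).
  move=> Is; rewrite -mulNr.
  exact: (is_derive1_comp (f := cos) (is_derive_cos _) (der_phi j s Is)).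
have der_S j s : I s ->
    is_derive s 1 (S j) (C j s * (lam j * `|B| * rho j s ^+ 2 * q s)).
  by move=> Is; exact: (is_derive1_comp (f := sin) (is_derive_sin _) (der_phi j s Is)).
have r_rho j s : I s -> r j s * rho j s = 1 by move=> Is; rewrite mulfV ?r0.
have CS j s : C j s ^+ 2 + S j s ^+ 2 = 1 by exact: cos2Dsin2.
have Pq s : I s -> P s * q s ^+ 2 = 1 + q s ^+ 2.
  by move=> Is; rewrite qE // /P mulrDl mulfV ?mul1r // gt_eqF ?Q0.
have beta2 : `|B| ^+ 2 = B ^+ 2 by exact: real_normK (num_real B).
have -> : F = immersion B `|B| (complex.Re K) (complex.Im K) lam r C S th.
  apply/funext => p; apply/rowP; elim/cvec_ind => [j||j|];
    rewrite cvecE /F /realify ?row_mxEl ?row_mxEr !mxE ?liftK ?unlift_none /=.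
  - by rewrite /C; ring.
  - by rewrite /zn; case: (K) => k1 k2 /=.
  - by rewrite /S; ring.
  - by rewrite /zn; case: (K) => k1 k2 /=.
have -> : realify T = cvec (fun=> 0) (fun=> 0) alpha 0.
  apply/rowP; elim/cvec_ind => [j||j|];
    rewrite cvecE /realify ?row_mxEl ?row_mxEr !mxE ?lift_max_neq ?eqxx //.
split.
  exact (lagrangian_immersion _ _ I_open hB r_rho CS der_r der_rho der_C der_S
    der_P der_q der_th).
move=> p Up.
exact (mean_curvature_immersion _ _ I_open hB beta2 r_rho CS Pq der_r der_rho der_C
  der_S der_P der_q der_th Up).
Qed.
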